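(* There exists a directed set $\mathcal A$, which is not a cardinal number (with its usual ordinal ordering), with $\operatorname{card}(\mathcal A)=\operatorname{cov}(\mathcal N)$, such that each of the families $\mathcal{NM}_{\mathcal A}$, $\mathcal{NF}_{\mathcal A}$ and $\mathcal{ND}_{\mathcal A}$ is positively $2^{\mathfrak c}$-coneable in the vector space $\left(\mathbb R^{[0,1]}\right)^{\mathcal A}$.
   Context: A directed set is a nonempty set $\mathcal A$ with a reflexive transitive relation $\le$ such that every two elements have an upper bound. A net $(x_A)_{A\in\mathcal A}$ in a topological space converges to $x$ if for every neighbourhood $U$ of $x$ there is $A_0$ with $x_A\in U$ for all $A\ge A_0$. For a bounded net of reals, $\liminf_{A\in\mathcal A}x_A$ is the infimum of the set of its cluster points ($x$ is a cluster point if for every neighbourhood $U$ of $x$ and every $A$ there is $A'\ge A$ with $x_{A'}\in U$). $\left(\mathbb R^{[0,1]}\right)^{\mathcal A}$ is the set of nets $(f_A)_{A\in\mathcal A}$ of functions $[0,1]\to\mathbb R$, a commutative real algebra under indexwise addition, indexwise pointwise multiplication, and scalar multiplication. $\lambda$ is Lebesgue measure, $\mathcal N$ the family of Lebesgue null subsets of $[0,1]$, $\operatorname{cov}(\mathcal N)$ the least cardinality of a subfamily of $\mathcal N$ covering $[0,1]$; $\mathfrak c=2^{\aleph_0}$. $\mathcal{NM}_{\mathcal A}$: nets of Lebesgue measurable $f_A:[0,1]\to\mathbb R$ such that (1) $A\le B$ implies $0\le f_A\le f_B$ a.e., (2) $(f_A)$ converges pointwise a.e. to some integrable $f$, (3)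 $\lim_{A}\int_{[0,1]}f_A\,d\lambda\ne\int_{[0,1]}f\,d\lambda$ (the net of integrals does not converge to $\int f$). $\mathcal{NF}_{\mathcal A}$: nets of Lebesgue measurable $f_A\ge0$ a.e. on $[0,1]$ such that $x\mapsto\liminf_{A}f_A(x)$ is integrable and $\int_{[0,1]}\liminf_A f_A\,d\lambda>\liminf_A\int_{[0,1]}f_A\,d\lambda$. $\mathcal{ND}_{\mathcal A}$: nets of Lebesgue measurable $f_A:[0,1]\to\mathbb R$ such that (1) there is an integrable $g$ with $|f_A|\le g$ a.e. for all $A$, (2) $f_A(x)\to f(x)$ a.e. for some integrable $f$, (3) $\int_{[0,1]}|f_A-f|\,d\lambda$ does not converge to $0$. A subset $S$ of a real vector space is positively $\kappa$-coneable if there is a linearly independent set $B\subset S$ with $\operatorname{card}(B)=\kappa$ such that every finite combination $\sum_{i=1}^n a_ix_i$ with $a_i>0$ and $x_i\in B$ lies in $S$. *)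

(* Defs.v *)
From mathcomp Require Import all_boot all_order all_algebra.
From mathcomp Require Import all_classical all_reals all_analysis.
Set Implicit Arguments.
Unset Strict Implicit.
Unset Printing Implicit Defensive.
Import Order.TTheory GRing.Theory Num.Theory.
Import numFieldNormedType.Exports.
Local Open Scope classical_set_scope.
Local Open Scope ring_scope.
Local Open Scope card_scope.

Definition directed (T : Type) (le : T -> T -> Prop) : Prop :=
  [/\ inhabited T,
      (forall a, le a a),
      (forall a b c, le a b -> le b c -> le a c) &
      (forall a b, exists c, le a c /\ le b c)].

(* (T, le) is (order-isomorphic to) a cardinal number with its usual ordinal
   ordering: le is a well-order (reflexive, antisymmetric, total, every
   nonempty subset has a least element) and it is an initial ordinal: no
   proper initial segment has the same cardinality as T. *)
Definition is_cardinal_order (T : Type) (le : T -> T -> Prop) : Prop :=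
  [/\ (forall a, le a a) /\ (forall a b, le a b -> le b a -> a = b),
      (forall a b c, le a b -> le b c -> le a c),
      (forall a b, le a b \/ le b a),
      (forall S : set T, S !=set0 -> exists2 m, S m & forall y, S y -> le m y) &
      (forall x : T, ~ ([set: T] #<= [set y | le y x /\ y <> x]))].

Definition net_cvg (A : Type) (le : A -> A -> Prop) (X : topologicalType)
  (u : A -> X) (x : X) : Prop :=
  forall U, nbhs x U -> exists a0, forall a, le a0 a -> U (u a).

Definition net_cluster (A : Type) (le : A -> A -> Prop) (X : topologicalType)
  (u : A -> X) (x : X) : Prop :=
  forall U, nbhs x U -> forall a, exists a', le a a' /\ U (u a').

(* liminf of a net of extended reals: infimum of its cluster points
   (for a bounded net of reals this is the usual liminf). *)
Definition net_liminf (A : Type) (le : A -> A -> Prop) (R : realType)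
  (u : A -> \bar R) : \bar R :=
  ereal_inf [set y | net_cluster le u y].

(* the measurable space of Lebesgue measurable subsets of R *)
Definition lebT (R : realType) : measurableType _ :=
  caratheodory_type (R:=R) (wlength (R:=R) idfun)^*%mu.

Definition leb (R : realType) : set (lebT R) -> \bar R :=
  @completed_lebesgue_measure R.

Definition itv01 (R : realType) : set (lebT R) := `[0%R, 1%R].

Arguments lebT R : clear implicits.
Arguments leb R : clear implicits.
Arguments itv01 R : clear implicits.

Definition I01 (R : realType) := {x : R | (0 <= x <= 1)%R}.

Definition ext (R : realType) (f : I01 R -> R) : lebT R -> R :=
  fun x => match @insub R (fun x => (0 <= x <= 1)%R) (I01 R) (x : R) with
               | Some y => f y | None => 0%R end.

Definition lmeas (R : realType) (f : I01 R -> R) : Prop :=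
  measurable_fun (itv01 R) (ext f).

Definition lintegrable (R : realType) (f : I01 R -> R) : Prop :=
  lmeas f /\ (leb R).-integrable (itv01 R) (EFin \o ext f).

Definition lint (R : realType) (f : I01 R -> R) : \bar R :=
  (\int[leb R]_(x in itv01 R) (ext f x)%:E)%E.

Definition ae01 (R : realType) (P : I01 R -> Prop) : Prop :=
  exists N : set (lebT R), (leb R).-negligible N /\
    forall y : I01 R, ~ N (val y) -> P y.

Definition card_is_covN (R : realType) (A : Type) : Prop :=
  (exists F : A -> set (lebT R),
      (forall a, F a `<=` itv01 R /\ (leb R).-negligible (F a)) /\
      itv01 R `<=` \bigcup_a F a) /\
  (forall F : set (set (lebT R)),
      (forall N, F N -> N `<=` itv01 R /\ (leb R).-negligible N) ->
      itv01 R `<=` \bigcup_(N in F) N ->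
      [set: A] #<= F).

Section families.
Variables (R : realType) (A : Type) (le : A -> A -> Prop).
Local Open Scope ereal_scope.

Definition NM : set (A -> I01 R -> R) := fun f =>
  (forall a, lmeas (f a)) /\
  (forall a b, le a b -> ae01 (fun x => (0 <= f a x <= f b x)%R)) /\
  exists g : I01 R -> R, lintegrable g /\
    ae01 (fun x => net_cvg (X:=R) le (fun a => f a x) (g x)) /\
    ~ net_cvg (X:=\bar R) le (fun a => lint (f a)) (lint g).

Definition NF : set (A -> I01 R -> R) := fun f =>
  (forall a, lmeas (f a)) /\
  (forall a, ae01 (fun x => (0 <= f a x)%R)) /\
  let h := fun x : lebT R =>
    net_liminf le (fun a => (ext (f a) x)%:E) in
  (leb R).-integrable (itv01 R) h /\
  (\int[leb R]_(x in itv01 R) h x) > net_liminf le (fun a => lint (f a)).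

Definition ND : set (A -> I01 R -> R) := fun f =>
  (forall a, lmeas (f a)) /\
  (exists g : I01 R -> R, lintegrable g /\
     forall a, ae01 (fun x => (`|f a x| <= g x)%R)) /\
  exists g : I01 R -> R, lintegrable g /\
    ae01 (fun x => net_cvg (X:=R) le (fun a => f a x) (g x)) /\
    ~ net_cvg (X:=\bar R) le (fun a => lint (fun x => `|f a x - g x|%R)) 0.

End families.

Definition lincomb (R : realType) (A : Type) (n : nat)
  (c : 'I_n -> R) (x : 'I_n -> A -> I01 R -> R) : A -> I01 R -> R :=
  fun a t => \sum_(i < n) c i * x i a t.

Definition lin_indep (R : realType) (A : Type) (B : set (A -> I01 R -> R)) :=
  forall n (c : 'I_n -> R) (x : 'I_n -> A -> I01 R -> R),
    injective x -> (forall i, B (x i)) ->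
    lincomb c x = (fun _ _ => 0) -> forall i, c i = 0.

Definition pos_coneable_2c (R : realType) (A : Type) (S : set (A -> I01 R -> R)) :=
  exists B : set (A -> I01 R -> R),
    [/\ B `<=` S, lin_indep B, B #= [set: set R] &
      forall n (c : 'I_n.+1 -> R) (x : 'I_n.+1 -> A -> I01 R -> R),
        (forall i, 0 < c i) -> (forall i, B (x i)) -> S (lincomb c x)].

(* Main.v *)
Require Import Defs.
From mathcomp Require Import all_boot all_order all_algebra.
From mathcomp Require Import all_classical all_reals all_analysis.
From mathcomp Require Import measurable_realfun.
From mathcomp Require Import lra.
Set Implicit Arguments.
Unset Strict Implicit.
Unset Printing Implicit Defensive.
Import Order.TTheory GRing.Theory Num.Theory.
Import numFieldNormedType.Exports.
Local Open Scope classical_set_scope.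
Local Open Scope card_scope.

(* Let [C] be a cover of [0,1] by null sets of least cardinality. It is
   infinite, so its finite subsets, represented by lists and ordered by
   inclusion of the underlying sets, form a directed set of cardinality
   cov(N). For [g : [0,1] -> R] the net [s |-> g * 1_(union of s)] consists of
   functions vanishing a.e. and is eventually equal to [g] at every point;
   if [g] is a.e. a positive constant, this one net violates monotone
   convergence, Fatou and dominated convergence. It remains to find 2^c
   linearly independent such [g] equal to 1 off the Cantor set: a point of the
   Cantor set codes a pair [(r, b)] of a real and a Boolean sequence, and for
   each set [T] of reals we take on the Cantor set the indicator of
   [{(r, b) | T (r n) <-> b n for all n}]. When [r] enumerates points that
   separate [T i] from finitely many other [T j], and [b] is the trace of [T i]
   on [r], only the function of [T i] is nonzero at [(r, b)]. *)

(** * Infinite cardinals *)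

(* A maximal set [G] of choice functions, no two of which agree anywhere, must
   project onto some [S i]; following [G] embeds that [S i] into every [S j]. *)
Lemma exists_minimal_card (I U : Type) (S : I -> set U) : inhabited I ->
  exists i, forall j, exists2 f : U -> U, set_fun (S i) (S j) f & set_inj (S i) f.
Proof.
case=> i0.
pose P (G : set (I -> U)) := forall g, G g -> (forall i, S i (g i)) /\
  forall h, G h -> forall i, g i = h i -> g = h.
have [F FP Ftot|G [PG Gmax]] := @Zorn_bigcup _ P.
  move=> g [X FX Xg]; split; first exact: (FP _ FX _ Xg).1.
  move=> h [Y FY Yh].
  case: (Ftot _ _ FX FY) => sub.
    exact: (FP _ FY _ (sub _ Xg)).2.
  exact: (FP _ FX _ Xg).2 (sub _ Yh).
have [i iG] : exists i, S i `<=` [set g i | g in G].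
  (* Otherwise a choice function avoiding, at every index, all values that [G] takes there could be
     added to [G]. *)
  apply: contrapT => /forallNP nG.
  have /choice[x xP] : forall i, exists u, S i u /\ ~ [set g i | g in G] u.
    by move=> i; have := nG i; move=> /existsNP[u /not_implyP[? ?]]; exists u.
  apply: (Gmax (G `|` [set x])).
    split; first by move=> g; left.
    move=> sub; have Gx : G x by apply: sub; right.
    by apply: (xP i0).2; exists x.
  move=> g [Gg|->]; split.
  - exact: (PG _ Gg).1.
  - move=> h [Gh|->] i; first exact: (PG _ Gg).2.
    by move=> e; case: (xP i).2; exists g.
  - by move=> i; exact: (xP i).1.
  - by move=> h [Gh|->] // i e; case: (xP i).2; exists h.
exists i => j.
have /choice[f fP] : forall u, exists v, S i u -> exists2 g, G g & g i = u /\ v = g j.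
  move=> u; case: (pselect (S i u)) => [Su|nSu]; last by exists u.
  by have [g Gg gu] := iG _ Su; exists (g j) => _; exists g.
exists f.
  move=> u /= Su; have [g Gg [_ ->]] := fP _ Su; exact: (PG _ Gg).1.
move=> u v /set_mem Su /set_mem Sv.
have [g Gg [gu ->]] := fP _ Su; have [h Gh [hv ->]] := fP _ Sv => e.
by rewrite -gu -hv ((PG _ Gg).2 _ Gh _ e).
Qed.

(* Zorn's lemma on the graphs of injections [D * D -> D] with [D] containing the
   range of [iota]. If [D] is maximal then its complement embeds into [D]:
   otherwise a copy of [D] in the complement, with three tags from the range of
   [iota], would extend the injection. *)
Lemma infinite_square_injection (X : Type) (iota : nat -> X) : injective iota ->
  exists f : X -> X -> X, forall x y x' y', f x y = f x' y' -> x = x' /\ y = y'.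
Proof.
move=> iotaI.
pose D (G : set (X * X * X)) x := exists z, G (x, x, z).
pose Q (G : set (X * X * X)) :=
  [/\ forall x y z z', G (x, y, z) -> G (x, y, z') -> z = z',
      forall x y x' y' z, G (x, y, z) -> G (x', y', z) -> x = x' /\ y = y',
      forall x y, D G x -> D G y -> exists z, G (x, y, z) &
      forall x y z, G (x, y, z) -> [/\ D G x, D G y & D G z]].
pose code (m n : nat) := pickle (m, n).
have codeI m n m' n' : code m n = code m' n' -> m = m' /\ n = n'.
  by move=> /(pcan_inj pickleK)[].
pose G0 := [set t | exists m n, t = (iota m, iota n, iota (code m n))].
have DG0 m : D G0 (iota m) by exists (iota (code m m)), m, m.
have QG0 : Q G0.
  split.
  - by move=> x y z z' [m [n [-> -> ->]]] [m' [n' [/iotaI-> /iotaI-> ->]]].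
  - move=> x y x' y' z [m [n [-> -> ->]]] [m' [n' [-> ->]]] /iotaI/codeI[-> ->].
    by [].
  - move=> x y [_ [m [_ [-> _ _]]]] [_ [n [_ [-> _ _]]]].
    by exists (iota (code m n)), m, n.
  - by move=> x y z [m [n [-> -> ->]]]; split; exact: DG0.
(* Zorn's lemma ranges over what is added to [G0], so that the empty chain causes no exception: its
   union gives [G0]. *)
have [F FP Ftot|G1 [QG G1max]] := @Zorn_bigcup _ (fun G => Q (G `|` G0)).
  set H := _ `|` G0.
  have key t1 t2 : H t1 -> H t2 -> exists K, [/\ Q K, K `<=` H, K t1 & K t2].
    have FH X' : F X' -> X' `|` G0 `<=` H.
      by move=> FX t [Xt|]; [left; exists X'|right].
    move=> [[X1 F1 X1t]|G1] [[X2 F2 X2t]|G2].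
    - have [s|s] := Ftot _ _ F1 F2.
      + exists (X2 `|` G0); split; [exact: FP|exact: FH|left; exact: s|by left].
      + exists (X1 `|` G0); split; [exact: FP|exact: FH|by left|left; exact: s].
    - exists (X1 `|` G0); split; [exact: FP|exact: FH|by left|by right].
    - exists (X2 `|` G0); split; [exact: FP|exact: FH|by right|by left].
    - by exists G0; split => //; right.
  split.
  - by move=> x y z z' h1 h2; have [K [[q _ _ _] _ /q]] := key _ _ h1 h2; apply.
  - by move=> x y x' y' z h1 h2; have [K [[_ q _ _] _ /q]] := key _ _ h1 h2; apply.
  - move=> x y [a h1] [b h2]; have [K [[_ _ q _] s k1 k2]] := key _ _ h1 h2.
    by have [||z Kz] := q x y; [exists a|exists b|exists z; exact: s].
  - move=> x y z h; have [K [[_ _ _ q] s k _]] := key _ _ h h.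
    have [[a ?] [b ?] [c ?]] := q _ _ _ k.
    by split; [exists a|exists b|exists c]; exact: s.
set G := G1 `|` G0 in QG.
have Gmax K : G `<=` K -> Q K -> K `<=` G.
  move=> GK QK; apply: contrapT => nKG; apply: (G1max K).
    split; first by move=> t G1t; apply: GK; left.
    by move=> KG1; apply: nKG => t /KG1; left.
  by rewrite setUidl// => t G0t; apply: GK; right.
have Dio m : D G (iota m) by have [z ?] := DG0 m; exists z; right.
case: QG => q1 q2 q3 q4.
have /choice[f' f'P] : forall p : X * X, exists z, D G p.1 -> D G p.2 -> G (p.1, p.2, z).
  move=> [x y] /=; case: (pselect (D G x /\ D G y)) => [[Dx Dy]|nD].
    by have [z ?] := q3 _ _ Dx Dy; exists z.
  by exists x => ? ?; case: nD.
pose f x y := f' (x, y).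
have fP x y : D G x -> D G y -> G (x, y, f x y) by move=> *; exact: (f'P (x, y)).
have fD x y : D G x -> D G y -> D G (f x y).
  by move=> Dx Dy; have [] := q4 _ _ _ (fP _ _ Dx Dy).
have fI x y x' y' : D G x -> D G y -> D G x' -> D G y' ->
    f x y = f x' y' -> x = x' /\ y = y'.
  move=> Dx Dy Dx' Dy' e; apply: (q2 _ _ _ _ (f x y)); first exact: fP.
  by rewrite e; exact: fP.
have [b bP] := @exists_minimal_card bool X
  (fun b => if b then ~` D G else D G) (inhabits true).
case: b bP => /=.
  move=> /(_ false)[q qD qI].
  (* The tags [iota 0] and [iota 1] keep [D G] and the copy of its complement apart, so [r] embeds
     all of [X] into [D G], where [f] is injective. *)
  pose r x := if pselect (D G x) then f (iota 0) x else f (iota 1) (q x).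
  have rD x : D G (r x).
    by rewrite /r; case: pselect => Dx; apply: (fD) => //; exact: qD.
  have rI : injective r.
    move=> x y; rewrite /r; case: pselect => Dx; case: pselect => Dy.
    - by move=> /fI[].
    - by move=> /fI[]//; [exact: qD|move=> /iotaI].
    - by move=> /fI[]//; [exact: qD|move=> /iotaI].
    - by move=> /fI[]//; [exact: qD|exact: qD|move=> _ /qI; apply; exact/mem_set].
  exists (fun x y => f (r x) (r y)) => x y x' y' /fI[]// /rI-> /rI->.
  by [].
move=> /(_ true)[q qD qI]; exfalso.
have qI' x y : D G x -> D G y -> q x = q y -> x = y.
  by move=> *; apply: qI => //; exact/mem_set.
pose e (b : bool) x := if b then q x else x.
have eI b x b' x' : D G x -> D G x' -> e b x = e b' x' -> b = b' /\ x = x'.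
  case: b b' => [] [] Dx Dx' //= E.
  - by have := qI' _ _ Dx Dx' E.
  - by case: (qD _ Dx); rewrite E.
  - by case: (qD _ Dx'); rewrite -E.
(* Value of a pair with at least one coordinate in the copy of [D G]; the tag, which is then 1, 2 or
   3, records which coordinates are new. *)
pose v (b b' : bool) x y := q (f (iota (b + b'.*2)) (f x y)).
pose K := [set t | G t \/ exists b b' x y,
  [/\ b || b', D G x, D G y & t = (e b x, e b' y, v b b' x y)]].
have DK b x : D G x -> D K (e b x).
  case: b => Dx; last by have [z ?] := Dx; exists z; left.
  by exists (v true true x x); right; exists true, true, x, x.
have DKE u : D K u -> exists b x, D G x /\ u = e b x.
  move=> [z [Gz|[b [b' [x [y [_ Dx Dy [-> _ _]]]]]]]].
    by exists false, u; split => //; exists z.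
  by exists b, x.
have vD b b' x y : D G x -> D G y -> D K (v b b' x y).
  by move=> Dx Dy; apply: (DK true); apply: (fD) => //; exact: fD.
have KG : K `<=` G.
  apply: Gmax; first by left.
  split.
  - move=> x y z z' [g|[b [b' [x1 [y1 [bb Dx Dy [-> -> ->]]]]]]].
    + move=> [g'|[b [b' [x1 [y1 [bb Dx Dy [xE yE zE]]]]]]].
        exact: q1 g g'.
      have [Du Dv _] := q4 _ _ _ g.
      have [b0 _] := eI false x b x1 Du Dx xE.
      have [b0' _] := eI false y b' y1 Dv Dy yE.
      by rewrite -b0 -b0' in bb.
    + move=> [g|[c [c' [x2 [y2 [cc Dx2 Dy2 [xE yE ->]]]]]]].
        have [Du Dv _] := q4 _ _ _ g.
        have [b0 _] := eI false _ b x1 Du Dx erefl.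
        have [b0' _] := eI false _ b' y1 Dv Dy erefl.
        by rewrite -b0 -b0' in bb.
      by have [-> ->] := eI _ _ _ _ Dx Dx2 xE; have [-> ->] := eI _ _ _ _ Dy Dy2 yE.
  - move=> x y x' y' z [g|[b [b' [x1 [y1 [bb Dx Dy [-> -> ->]]]]]]].
    + move=> [g'|[b [b' [x1 [y1 [bb Dx Dy [xE yE zE]]]]]]].
        exact: q2 g g'.
      have [_ _] := q4 _ _ _ g; rewrite zE => vz; case: (qD _ _ vz).
      by apply: (fD) => //; exact: fD.
    + move=> [g|[c [c' [x2 [y2 [cc Dx2 Dy2 [-> ->]]]]]]].
        have [_ _ vz] := q4 _ _ _ g; case: (qD _ _ vz).
        by apply: (fD) => //; exact: fD.
      move=> /qI' E.
      have {E} : f (iota (b + b'.*2)) (f x1 y1) = f (iota (c + c'.*2)) (f x2 y2).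
        by apply: E; apply: (fD) => //; exact: fD.
      move=> /fI[]//; [exact: fD|exact: fD|move=> /iotaI t /fI[]// <- <-].
      have {t} : b = c /\ b' = c' by move: t; case: b b' c c' {bb cc} => [] [] [] [].
      by move=> [-> ->].
  - move=> x y /DKE[b [x1 [Dx ->]]] /DKE[b' [y1 [Dy ->]]].
    have [bb|] := boolP (b || b').
      by exists (v b b' x1 y1); right; exists b, b', x1, y1.
    by case: b b' => [] []//= _; exists (f x1 y1); left; exact: fP.
  - move=> x y z [g|[b [b' [x1 [y1 [bb Dx Dy [-> -> ->]]]]]]].
      have [Dx Dy Dz] := q4 _ _ _ g.
      by split; exact: (DK false).
    by split; [exact: DK|exact: DK|exact: vD].
(* [q (iota 0)] is in the domain of [K], hence of [G] by maximality, although [q] maps into the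
   complement. *)
have : D G (q (iota 0)).
  by have [z Kz] := DK true _ (Dio 0); exists z; exact: KG.
exact: qD.
Qed.

(** The pairing is folded along the list. The length is recorded as well, because the base value
    [iota 0] may itself be the code of a pair. *)
Lemma seq_injection (X : Type) (iota : nat -> X) : injective iota ->
  exists h : seq X -> X, injective h.
Proof.
move=> iotaI; have [f fI] := infinite_square_injection iotaI.
exists (fun s => f (iota (size s)) (foldr f (iota 0) s)) => s t /fI[/iotaI].
elim: s t => [|x s IH] [|y t]//= [st] /fI[-> e].
by rewrite (IH t).
Qed.

(** * Integration of functions that are a.e. constant *)

Local Open Scope ring_scope.

Section measure.
Variable R : realType.
Implicit Types (f g : I01 R -> R) (c : R).

Lemma measurable_itv_leb (a b : R) : measurable (`[a, b] : set (lebT R)).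
Proof. by apply: sub_caratheodory; exact: measurable_itv. Qed.

Lemma leb_itv (a b : R) : a <= b -> leb R `[a, b] = (b - a)%:E.
Proof.
move=> ab; have := lebesgue_measure_itv `[a, b].
rewrite [lebesgue_measure _](_ : _ = leb R `[a, b])// => ->/=.
rewrite lte_fin; case: ltP => // ba.
have -> : a = b by apply/eqP; rewrite eq_le ab.
by rewrite subrr.
Qed.

Lemma leb_itv01 : leb R (itv01 R) = 1%E.
Proof. by rewrite /itv01 leb_itv// subr0. Qed.

Lemma itv01_val (x : lebT R) : itv01 R x -> exists y : I01 R, x = val y.
Proof. by rewrite /itv01 /= in_itv/= => h; exists (Sub (x : R) h). Qed.

Lemma ext_val f y : ext f (val y) = f y.
Proof. by rewrite /ext valK. Qed.

Section ae_constant.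
Variables (h : lebT R -> \bar R) (c : R) (N : set (lebT R)).
Hypotheses (negN : (leb R).-negligible N)
  (hc : forall y : I01 R, ~ N (val y) -> h (val y) = c%:E).

Let ae_cst : ae_eq (leb R) (itv01 R) h (cst c%:E).
Proof.
apply: negligibleS negN => x /= /not_implyP[/itv01_val[y ->] hy].
by apply: contrapT => /hc.
Qed.

(** Completeness of the measure: [h] is arbitrary on the null set [N], as the functions built below
    are on the Cantor set. *)
Lemma ae_cst_measurable : measurable_fun (itv01 R) h.
Proof.
apply: (ae_measurable_fun (@completed_lebesgue_measure_is_complete R)).
  exact/ae_eq_sym/ae_cst.
exact: measurable_cst.
Qed.

Lemma ae_cst_integral : (\int[leb R]_(x in itv01 R) h x)%E = c%:E.
Proof.
have mI := measurable_itv_leb 0 1.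
rewrite (ae_eq_integral (cst c%:E) h mI _ _ ae_cst)//; last exact: ae_cst_measurable.
by rewrite integral_cst// -[RHS]mule1 -leb_itv01.
Qed.

End ae_constant.

Lemma ae_cst_integrable h c N : (leb R).-negligible N ->
  (forall y : I01 R, ~ N (val y) -> h (val y) = c%:E) ->
  (leb R).-integrable (itv01 R) h.
Proof.
move=> negN hc; apply/integrableP; split; first exact: ae_cst_measurable negN hc.
rewrite (@ae_cst_integral _ `|c| _ negN) ?ltry// => y /hc ->.
by rewrite abse_EFin.
Qed.

Lemma ae_cst_lmeas f c : ae01 (fun x => f x = c) -> lmeas f.
Proof.
move=> [N [negN fc]]; apply/measurable_EFinP.
by apply: (@ae_cst_measurable _ c _ negN) => y /fc; rewrite /= ext_val => ->.
Qed.

Lemma ae_cst_lint f c : ae01 (fun x => f x = c) -> lint f = c%:E.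
Proof.
move=> [N [negN fc]]; apply: (@ae_cst_integral _ c _ negN) => y /fc.
by rewrite ext_val => ->.
Qed.

Lemma ae_cst_lintegrable f c : ae01 (fun x => f x = c) -> lintegrable f.
Proof.
move=> fae; split; first exact: ae_cst_lmeas fae.
have [N [negN fc]] := fae; apply: (@ae_cst_integrable _ c _ negN) => y /fc.
by rewrite /= ext_val => ->.
Qed.

Lemma ae01W (P Q : I01 R -> Prop) : (forall x, P x -> Q x) -> ae01 P -> ae01 Q.
Proof. by move=> PQ [N [negN NP]]; exists N; split => // y /NP /PQ. Qed.

Lemma ae01T (P : I01 R -> Prop) : (forall x, P x) -> ae01 P.
Proof. by move=> PT; exists set0; split => //; exact: negligible_set0. Qed.

Lemma itv01_not_negligible : ~ (leb R).-negligible (itv01 R).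
Proof.
move=> /(negligibleP _ (measurable_itv_leb 0 1)) /esym.
by rewrite [RHS]leb_itv01 => /eqP; rewrite eqe eq_sym oner_eq0.
Qed.

End measure.

(** * Limits and lower limits of eventually constant nets *)

Section nets.
Variables (A : Type) (le : A -> A -> Prop).
Hypothesis dle : directed le.

Lemma net_cvg_eventually (X : topologicalType) (u : A -> X) x :
  (exists a0, forall a, le a0 a -> u a = x) -> net_cvg le u x.
Proof.
move=> [a0 ux] U xU; exists a0 => a /ux ->; exact: nbhs_singleton.
Qed.

Lemma hausdorff_eq (X : topologicalType) (x y : X) : hausdorff_space X ->
  (forall U, nbhs y U -> U x) -> x = y.
Proof.
move=> hX xy; apply: hX => U V xU yV.
by exists x; split; [exact: nbhs_singleton|exact: xy].
Qed.

Lemma net_cvg_cst (X : topologicalType) (x y : X) : hausdorff_space X ->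
  net_cvg le (fun=> x) y -> x = y.
Proof.
move=> hX xy; apply: hausdorff_eq => // U /xy[a]; apply.
by case: dle => _ + _ _.
Qed.

(** The eventual value is a cluster point by directedness, and the only one by separation. *)
Lemma net_liminf_eventually (R : realType) (u : A -> \bar R) x :
  (exists a0, forall a, le a0 a -> u a = x) -> net_liminf le u = x.
Proof.
move=> [a0 ux]; have [_ _ trans dir] := dle.
rewrite /net_liminf [X in ereal_inf X](_ : _ = [set x]) ?ereal_inf1//.
apply/seteqP; split => [y yc|_ ->] /=.
  apply/esym/hausdorff_eq; first exact: ereal_hausdorff.
  by move=> U /yc /(_ a0)[a [/ux ->]].
move=> U xU a; have [b [a0b ab]] := dir a0 a.
by exists b; rewrite (ux _ a0b); split => //; exact: nbhs_singleton.
Qed.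

End nets.

(** * Nets of a.e. vanishing functions against the three convergence theorems *)

Section null_nets.
Variables (R : realType) (A : Type) (le : A -> A -> Prop).
Hypothesis dle : directed le.
Variables (f : A -> I01 R -> R) (g : I01 R -> R) (c : R).
Hypotheses (c0 : 0 < c) (gc : ae01 (fun x => g x = c))
  (f0 : forall a, ae01 (fun x => f a x = 0))
  (fg : forall x, exists a0, forall a, le a0 a -> f a x = g x).

Let f_lmeas a : lmeas (f a). Proof. exact: ae_cst_lmeas (f0 a). Qed.

Let f_lint a : lint (f a) = 0%E. Proof. exact: ae_cst_lint (f0 a). Qed.

(** All integrals of the net are 0, and a constant net in a Hausdorff space has no other limit,
    whereas [g] integrates to [c]. *)
Lemma null_net_NM : (forall a b x, le a b -> 0 <= f a x <= f b x) -> NM le f.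
Proof.
move=> fle; split=> //; split.
  by move=> a b ab; apply: ae01T => x; exact: fle.
exists g; split; first exact: ae_cst_lintegrable gc.
split; first by apply: ae01T => x; exact: net_cvg_eventually.
rewrite (ae_cst_lint gc) (funext f_lint) => /(net_cvg_cst dle (@ereal_hausdorff R)).
by move=> /eqP; rewrite eqe eq_sym gt_eqF.
Qed.

Lemma null_net_NF : NF le f.
Proof.
split=> //; split; first by move=> a; apply: ae01W (f0 a) => x ->.
have [N [negN Nc]] := gc.
set h := fun x => _.
have hc (y : I01 R) : ~ N (val y) -> h (val y) = c%:E.
  move=> Ny; apply: net_liminf_eventually => //.
  by have [a0 fa0] := fg y; exists a0 => a /fa0; rewrite ext_val (Nc _ Ny) => ->.
split; first exact: ae_cst_integrable negN hc.
rewrite (ae_cst_integral negN hc) (funext f_lint).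
have [[a] _ _ _] := dle.
by rewrite (@net_liminf_eventually _ _ dle _ _ 0%E) ?lte_fin//; exists a.
Qed.

(** The limit [g] is itself the dominating function, and each distance of [f a] to [g] integrates to
    [c]. *)
Lemma null_net_ND : (forall a x, 0 <= f a x <= g x) -> ND le f.
Proof.
move=> fle; split=> //; split.
  exists g; split; first exact: ae_cst_lintegrable gc.
  by move=> a; apply: ae01T => x; have /andP[f0x fgx] := fle a x; rewrite ger0_norm.
exists g; split; first exact: ae_cst_lintegrable gc.
split; first by apply: ae01T => x; exact: net_cvg_eventually.
have fgc a : lint (fun x => `|f a x - g x|) = c%:E.
  apply: ae_cst_lint; have [[N [negN Ng]] [M [negM Mf]]] := (gc, f0 a).
  exists (N `|` M); split; first exact: negligibleU.
  by move=> y /not_orP[/Ng -> /Mf ->]; rewrite sub0r normrN gtr0_norm.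
rewrite (funext fgc) => /(net_cvg_cst dle (@ereal_hausdorff R)).
by move=> /eqP; rewrite eqe gt_eqF.
Qed.

End null_nets.

(** * The Cantor set and an independent family of functions *)

Section cantor_set.
Variable R : realType.
Implicit Types (z : nat -> bool) (a d : R).

(** Ternary expansion with digits 0 and 2, truncated after [n] digits; [cantor_point] is its limit,
    taken as a supremum. *)
Definition cantor_sum z n : R := \sum_(i < n) (z i)%:R * (2 * 3^-1 ^+ i.+1).

Definition cantor_point z : R := sup (range (cantor_sum z)).

(** Stage [n] of the middle-thirds construction started from the interval [[a, a + d]]. *)
Fixpoint cantor_cover n a d : set (lebT R) :=
  if n is n'.+1 then
    cantor_cover n' a (d / 3) `|` cantor_cover n' (a + 2 * (d / 3)) (d / 3)
  else `[a, a + d].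

Lemma cantor_sumS z n :
  cantor_sum z n.+1 = cantor_sum z n + (z n)%:R * (2 * 3^-1 ^+ n.+1).
Proof. by rewrite /cantor_sum big_ord_recr. Qed.

(** The truncations increase, while truncation plus tail bound decreases; the two are compared at
    [m + n]. *)
Lemma cantor_sum_le z m n : cantor_sum z m <= cantor_sum z n + 3^-1 ^+ n.
Proof.
have p0 k : 0 < 3^-1 ^+ k :> R by rewrite exprn_gt0.
have up k l : cantor_sum z k <= cantor_sum z (k + l).
  elim: l => [|l IH]; first by rewrite addn0.
  rewrite addnS cantor_sumS (le_trans IH)// lerDl.
  by have := p0 (k + l).+1; case: (z _) => /=; lra.
have down k l : cantor_sum z (k + l) + 3^-1 ^+ (k + l) <= cantor_sum z k + 3^-1 ^+ k.
  elim: l => [|l IH]; first by rewrite addn0.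
  rewrite addnS (le_trans _ IH)// cantor_sumS exprS -addrA lerD2l.
  by have := p0 (k + l)%N; case: (z _) => /=; lra.
have := up m n; have := down n m; rewrite [(n + m)%N]addnC.
by have := p0 (m + n)%N; lra.
Qed.

Lemma cantor_sum_le_point z n : cantor_sum z n <= cantor_point z.
Proof.
apply: sup_upper_bound; last by exists n.
split; first by exists (cantor_sum z 0), 0%N.
by exists (cantor_sum z 0 + 3^-1 ^+ 0) => _ [m _ <-]; exact: cantor_sum_le.
Qed.

Lemma cantor_point_le_sum z n : cantor_point z <= cantor_sum z n + 3^-1 ^+ n.
Proof.
apply: ge_sup; first by exists (cantor_sum z 0), 0%N.
by move=> _ [m _ <-]; exact: cantor_sum_le.
Qed.

Lemma cantor_point01 z : 0 <= cantor_point z <= 1.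
Proof.
have := cantor_sum_le_point z 0; have := cantor_point_le_sum z 0.
by rewrite /cantor_sum big_ord0 add0r expr0 => -> ->.
Qed.

(** At the first differing digit the truncations are [2 * 3^-1 ^+ n.+1] apart, and the tails
    contribute at most half of that. *)
Lemma cantor_point_inj : injective cantor_point.
Proof.
move=> z z' zz'; apply/funext => n.
elim/ltn_ind: n => n IH.
have s : cantor_sum z n = cantor_sum z' n.
  by apply: eq_bigr => i _; rewrite IH.
have := cantor_sum_le_point z n.+1; have := cantor_sum_le_point z' n.+1.
have := cantor_point_le_sum z n.+1; have := cantor_point_le_sum z' n.+1.
rewrite !cantor_sumS zz' s.
have : 0 < 3^-1 ^+ n.+1 :> R by rewrite exprn_gt0.
by case: (z n); case: (z' n) => //=; lra.
Qed.

Lemma measurable_cantor_cover n a d : measurable (cantor_cover n a d).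
Proof.
elim: n a d => [|n IH] a d /=; first exact: measurable_itv_leb.
exact: measurableU.
Qed.

Lemma leb_cantor_cover n a d : 0 <= d ->
  (leb R (cantor_cover n a d) <= ((2 / 3) ^+ n * d)%:E)%E.
Proof.
elim: n a d => [|n IH] a d d0 /=.
  by rewrite leb_itv ?lerDl// addrAC subrr add0r expr0 mul1r.
apply: le_trans.
  exact: (measureU2 (completed_lebesgue_measure)
    (measurable_cantor_cover _ _ _) (measurable_cantor_cover _ _ _)).
have d3 : 0 <= d / 3 by lra.
apply: le_trans (leeD (IH a _ d3) (IH (a + 2 * (d / 3)) _ d3)) _.
by rewrite -EFinD lee_fin exprS; lra.
Qed.

(** Digit [z k] decides which outer third contains the point. The induction needs every [k], since a
    stage less means a digit more. *)
Lemma cantor_cover_point n z k :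
  cantor_cover n (cantor_sum z k) (3^-1 ^+ k) (cantor_point z).
Proof.
elim: n k => [|n IH] k /=.
  by rewrite in_itv/= cantor_sum_le_point cantor_point_le_sum.
have := IH k.+1; rewrite cantor_sumS exprSr.
by case: (z k); [rewrite mul1r; right|rewrite mul0r addr0; left].
Qed.

Lemma range_cantor_point_negligible :
  (leb R).-negligible (range cantor_point : set (lebT R)).
Proof.
exists (\bigcap_n cantor_cover n 0 1).
have mC n : measurable (cantor_cover n 0 1) by exact: measurable_cantor_cover.
split; first exact: bigcapT_measurable.
  apply/eqP; rewrite eq_le measure_ge0 andbT.
  apply/lee_addgt0Pr => e e0; rewrite add0e.
  have : (fun n => (2 / 3) ^+ n : R) @ \oo --> (0 : R).
    by apply: cvg_expr; rewrite ger0_norm; lra.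
  move=> /cvgr_lt /(_ _ e0) [n _ /(_ n (leqnn n)) /= ne].
  apply: (@le_trans _ _ (leb R (cantor_cover n 0 1))).
    by apply: le_measure; rewrite ?inE//; [exact: bigcapT_measurable|exact: bigcap_inf].
  apply: le_trans (leb_cantor_cover _ _ _) _ => //.
  by rewrite mulr1 lee_fin ltW.
move=> _ [z _ <-] n _.
have := cantor_cover_point n z 0.
by rewrite /cantor_sum big_ord0 expr0.
Qed.

End cantor_set.

Section independent_family.
Variable R : realType.
Implicit Types (T : set R) (r : nat -> R) (b : nat -> bool).

(* The reals are coded by their Dedekind cuts. *)
Definition pair_code r b : nat -> bool := fun k =>
  match unpickle k : option (nat * option rat) with
  | Some (n, Some q) => ratr q < r n
  | Some (n, None) => b n
  | None => false
  end.

Lemma pair_code_inj r b r' b' : pair_code r b = pair_code r' b' ->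
  r = r' /\ b = b'.
Proof.
move=> e.
have e' (p : nat * option rat) : pair_code r b (pickle p) = pair_code r' b' (pickle p).
  by rewrite e.
split; apply/funext => n; last first.
  by have := e' (n, None); rewrite /pair_code pickleK.
wlog: r r' b b' {e} e' / r n < r' n => [hw|rr'].
  have [h|h|//] := ltgtP (r n) (r' n); first exact: (hw r r' b b').
  by apply/esym/(hw r' r b' b) => // p; rewrite e'.
(* A rational in between belongs to the cut of [r' n] but not to that of [r n]. *)
have [q] := rat_in_itvoo rr'; rewrite in_itv/= => /andP[q1 q2].
by have := e' (n, Some q); rewrite /pair_code pickleK q2 ltNge (ltW q1).
Qed.

(* [1] off the Cantor set, and on the Cantor set the indicator of the codes of
   the pairs [(r, b)] for which [b] is the trace of [T] on [r]. *)
Definition trace_fun T (x : I01 R) : R :=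
  `[< forall r b, val x = cantor_point R (pair_code r b) ->
        forall n, T (r n) <-> b n >]%:R.

Lemma trace_fun_off_cantor T x :
  ~ range (cantor_point R) (val x) -> trace_fun T x = 1.
Proof.
move=> Cx; rewrite /trace_fun asboolT// => r b xE; case: Cx.
by exists (pair_code r b).
Qed.

Lemma trace_fun_dual n (T : 'I_n -> set R) (i : 'I_n) : injective T ->
  exists x, forall j, trace_fun (T j) x = (j == i)%:R.
Proof.
move=> Tinj.
(* Entry [k] of [r] separates [T k] from [T i]; the value 0 for [k = i] or [k >= n] is a filler. *)
have /choice[r rP] : forall k : nat, exists u, forall j : 'I_n,
    val j = k -> j != i -> ~ (T j u <-> T i u).
  move=> k; have [kn|nk] := ltnP k n; last first.
    by exists 0 => j jk; have := ltn_ord j; rewrite [nat_of_ord j]jk ltnNge nk.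
  have [ki|ki] := eqVneq (Ordinal kn) i.
    by exists 0 => j jk /eqP[]; rewrite -ki; exact: val_inj.
  have : T (Ordinal kn) <> T i by move=> /Tinj/eqP; rewrite (negbTE ki).
  move=> neq; have [u uP] : exists u, ~ (T (Ordinal kn) u <-> T i u).
    apply: contrapT => /forallNP h; apply: neq; apply/seteqP.
    by split => u; have /contrapT[] := h u.
  by exists u => j jk _; have -> : j = Ordinal kn by exact: val_inj.
pose b k := `[< T i (r k) >].
exists (exist (fun x : R => 0 <= x <= 1) _ (cantor_point01 R (pair_code r b))) => j.
congr (nat_of_bool _)%:R; apply/asboolP/eqP => [|->].
  move=> /(_ r b erefl) h; apply/eqP; apply: contrapT => /negP ji.
  by apply: (rP j j erefl ji); rewrite h; split => /asboolP.
move=> r' b' /cantor_point_inj/pair_code_inj[<- <-] k.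
by split => /asboolP.
Qed.

End independent_family.

(** * Nets indexed by the finite subsets of a null cover *)

Lemma card_le_fun T U (A : set T) (B : set U) (f : T -> U) :
  set_fun A B f -> set_inj A f -> A #<= B.
Proof.
move=> fun_f inj_f.
have [g] : $|{injfun A >-> B}| by apply/injfunPex; exists f.
exact: inj_card_le g.
Qed.

Section minimal_cover.
Variable R : realType.

Definition null_cover (C : set (set (lebT R))) :=
  (forall N, C N -> N `<=` itv01 R /\ (leb R).-negligible N) /\
  itv01 R `<=` \bigcup_(N in C) N.

(** Provides some null cover, so that a least one can be chosen. *)
Lemma null_cover_singletons : null_cover [set [set x] | x in itv01 R].
Proof.
split=> [_ [x xI <-]|x xI]; last by exists [set x] => //; exists x.
split; first by move=> _ ->.
exists (`[(x : R), (x : R)]%classic : set (lebT R)).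
split; first exact: measurable_itv_leb.
  by rewrite leb_itv// subrr.
by move=> _ ->; rewrite /= in_itv/= lexx.
Qed.

Lemma null_cover_infinite C : null_cover C -> infinite_set C.
Proof.
move=> [C0 IC] /finite_set_countable /pfcard_geP[CE|/surjfunPex[f CE]].
  have : itv01 R (0 : R) by rewrite /itv01 /= in_itv/= lexx ler01.
  by move=> /IC[N]; rewrite CE.
apply: (@itv01_not_negligible R).
apply: (@negligibleS _ _ _ _ (\bigcup_k f k)).
  by move=> x /IC[N]; rewrite CE => -[k _ <-] ?; exists k.
by apply: negligible_bigcup => k; apply: (C0 _ _).2; rewrite CE; exists k.
Qed.

(** [exists_minimal_card] is applied to the family of all null covers, indexed by itself. *)
Lemma minimal_null_cover :
  exists2 C, null_cover C & forall C', null_cover C' -> C #<= C'.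
Proof.
have [|[C cC] Cmin] := @exists_minimal_card {C | null_cover C} _ sval.
  exact: (inhabits (exist _ _ null_cover_singletons)).
exists C => // C' cC'; have [f] := Cmin (exist _ C' cC').
exact: card_le_fun.
Qed.

(** An infinite set absorbs its finite lists; this keeps the index set from exceeding cov(N). *)
Lemma seq_null_cover_card C : null_cover C ->
  [set: seq {N | C N}] #<= C.
Proof.
move=> cC; have /infiniteP/pcard_leP[f] := null_cover_infinite cC.
have fC k : C (f k) by exact: funS.
have [|h hI] := @seq_injection {N | C N} (fun k => exist _ _ (fC k)).
  by move=> m n [] /(@inj _ _ _ f) mn; apply: mn; rewrite inE.
apply: (@card_le_trans _ _ _ [set: {N | C N}]).
  by apply: (@card_le_fun _ _ _ _ h) => // s t _ _; exact: hI.
apply: (@card_le_fun _ _ _ _ sval); first by move=> [].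
by move=> [N CN] [M CM] _ _ /=; exact: eq_exist.
Qed.

End minimal_cover.

Section finite_subsets.
Variable X : Type.
Implicit Types s t : seq X.

(* Inclusion of the underlying finite sets, for a type without decidable
   equality. *)
Definition seq_sub s t := forall P : pred X, has P s -> has P t.

Lemma directed_seq_sub : directed seq_sub.
Proof.
split=> [|s P //|s t u st tu P /st/tu//|s t]; first exact: (inhabits [::]).
by exists (s ++ t); split => P; rewrite has_cat => ->; rewrite ?orbT.
Qed.

(** Repeating an entry gives a different list with the same underlying set, so antisymmetry
    fails. *)
Lemma not_cardinal_seq_sub : inhabited X -> ~ is_cardinal_order seq_sub.
Proof.
move=> [x] [[_ anti] _ _ _ _].
suff : [:: x] = [:: x; x] by [].
by apply: anti => P /=; rewrite !orbF orbb.
Qed.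

End finite_subsets.

Section positive_cone.
Variables (R : realType) (X : Type) (F : X -> set (lebT R)).
Hypotheses (negF : forall k, (leb R).-negligible (F k))
  (covF : itv01 R `<=` \bigcup_k F k).
Implicit Types (s : seq X) (x : I01 R).

Definition covered s x := has (fun k => `[< F k (val x) >]) s.

Definition cover_net (g : I01 R -> R) s x : R := if covered s x then g x else 0.

Lemma covered_eventually x : exists s0, forall s, seq_sub s0 s -> covered s x.
Proof.
have [|k _ Fkx] := @covF (val x).
  by rewrite /itv01 /= in_itv/=; exact: (svalP x).
by exists [:: k] => s; apply; rewrite /= orbF; exact/asboolP.
Qed.

Lemma covered_negligible s : ae01 (fun x => ~~ covered s x).
Proof.
elim: s => [|k s [N [negN Ns]]]; first exact: ae01T.
exists (F k `|` N); split; first exact: negligibleU.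
by move=> y /not_orP[Fy /Ns sy]; rewrite /covered /= asboolF.
Qed.

(** By linearity in [g], a combination of cover nets is a single cover net, to which the lemmas on
    null nets apply. *)
Lemma lincomb_cover_net n (c : 'I_n -> R) (g : 'I_n -> I01 R -> R) :
  lincomb c (fun i => cover_net (g i)) =
  cover_net (fun x => \sum_(i < n) c i * g i x).
Proof.
apply/funext => s; apply/funext => x; rewrite /lincomb /cover_net.
by case: ifP => // _; rewrite big1// => i _; rewrite mulr0.
Qed.

Lemma lincomb_trace_net_null n (c : 'I_n.+1 -> R) (T : 'I_n.+1 -> set R) :
  (forall i, 0 < c i) ->
  let f := lincomb c (fun i => cover_net (trace_fun (T i))) in
  [/\ NM (@seq_sub X) f, NF (@seq_sub X) f & ND (@seq_sub X) f].
Proof.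
move=> c0 /=; rewrite lincomb_cover_net.
set g := fun x => _.
have g0 x : 0 <= g x by apply: sumr_ge0 => i _; rewrite mulr_ge0// ltW.
have csum0 : 0 < \sum_(i < n.+1) c i.
  by rewrite big_ord_recl ltr_pwDl// sumr_ge0// => i _; exact: ltW.
have gc : ae01 (fun x => g x = \sum_(i < n.+1) c i).
  exists (range (cantor_point R)); split; first exact: range_cantor_point_negligible.
  by move=> x Cx; apply: eq_bigr => i _; rewrite trace_fun_off_cantor ?mulr1.
have dX := directed_seq_sub X.
have f0 s : ae01 (fun x => cover_net g s x = 0).
  by apply: ae01W (covered_negligible s) => x /negbTE; rewrite /cover_net => ->.
have fg x : exists s0, forall s, seq_sub s0 s -> cover_net g s x = g x.
  by have [s0 h] := covered_eventually x; exists s0 => s /h; rewrite /cover_net => ->.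
split.
- apply: (null_net_NM dX csum0 gc f0 fg) => s t x st.
  rewrite /cover_net; case: ifP => [/st tx|_].
    by rewrite [covered t x]tx g0 lexx.
  by rewrite lexx; case: ifP => _; rewrite ?g0 ?lexx.
- exact: null_net_NF csum0 gc f0 fg.
- apply: (null_net_ND dX csum0 gc f0 fg) => s x.
  by rewrite /cover_net; case: ifP => _; rewrite g0 lexx.
Qed.

Lemma trace_net_dual n (T : 'I_n -> set R) (i : 'I_n) : injective T ->
  exists s x, forall j, cover_net (trace_fun (T j)) s x = (j == i)%:R.
Proof.
move=> /(trace_fun_dual i)[x xP]; have [s sx] := covered_eventually x.
by exists s, x => j; rewrite /cover_net sx.
Qed.

(** Two distinct sets form an injective family of length 2, and a dual point tells their nets apart.
    Hence there are as many nets as sets of reals. *)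
Lemma trace_net_inj : injective (fun T : set R => cover_net (trace_fun T)).
Proof.
move=> T T' e; apply: contrapT => TT'.
pose U (i : 'I_2) := if i == ord0 then T else T'.
have UI : injective U.
  move=> [[|[|//]] ?] [[|[|//]] ?]; rewrite /U /= => E; apply: val_inj => //.
  by case: TT'.
have [s [x xP]] := trace_net_dual ord0 UI.
have := xP ord0; have := xP ord_max; rewrite /U /= e => -> /eqP.
by rewrite eq_sym oner_eq0.
Qed.

Lemma pos_coneable_trace_net (S : set (seq X -> I01 R -> R)) :
  (forall n (c : 'I_n.+1 -> R) T, (forall i, 0 < c i) ->
    S (lincomb c (fun i => cover_net (trace_fun (T i))))) ->
  pos_coneable_2c S.
Proof.
move=> HS; exists (range (fun T : set R => cover_net (trace_fun T))).
have pick n (u : 'I_n -> seq X -> I01 R -> R) :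
    (forall i, range (fun T : set R => cover_net (trace_fun T)) (u i)) ->
    exists T, u = fun i => cover_net (trace_fun (T i)).
  move=> uB; have /choice[T TP] : forall i, exists T, cover_net (trace_fun T) = u i.
    by move=> i; have [T _ <-] := uB i; exists T.
  by exists T; apply/funext => i; rewrite TP.
split.
(* A generator is the combination of length 1 with coefficient 1. *)
- move=> _ [T _ <-]; have := HS 0%N (fun=> 1) (fun=> T) (fun=> ltr01).
  rewrite (_ : lincomb _ _ = cover_net (trace_fun T))//.
  by apply/funext => s; apply/funext => x; rewrite /lincomb big_ord1 mul1r.
- move=> n c u uI /pick[T uE]; rewrite uE in uI * => c0 i.
  have TI : injective T by move=> j k e; apply: uI; rewrite e.
  have [s [x xP]] := trace_net_dual i TI.
  (* Evaluation at the dual index and point of [T i] leaves only the coefficient [c i]. *)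
  have := congr1 (fun h => h s x) c0; rewrite /lincomb (bigD1 i)//= xP eqxx mulr1.
  rewrite big1 ?addr0// => j ji.
  by rewrite xP (negbTE ji) mulr0.
- by apply: inj_card_eq => T T' _ _; exact: trace_net_inj.
- by move=> n c u c0 /pick[T ->]; exact: HS.
Qed.

End positive_cone.

Theorem mainTheorem1 (R : realType) :
  exists (A : Type) (le : A -> A -> Prop),
    [/\ directed le /\ ~ is_cardinal_order le,
        card_is_covN R A,
        pos_coneable_2c (@NM R A le),
        pos_coneable_2c (@NF R A le) &
        pos_coneable_2c (@ND R A le)].
Proof.
have [C cC Cmin] := minimal_null_cover R.
pose X := {N | C N}; pose F (k : X) := sval k.
have negF k : (leb R).-negligible (F k) by exact: (cC.1 _ (svalP k)).2.
have covF : itv01 R `<=` \bigcup_k F k.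
  by move=> x /cC.2[N CN Nx]; exists (exist _ N CN).
have null n c T c0 := @lincomb_trace_net_null R X F negF covF n c T c0.
exists (seq X), (@seq_sub X); split.
- split; first exact: directed_seq_sub.
  apply: not_cardinal_seq_sub.
  have /infinite_setN0[N CN] := null_cover_infinite cC.
  exact: (inhabits (exist _ N CN)).
- split.
    (* A list stands for the null set at its head, so one-element lists already cover the interval;
       the empty list gets the empty set. *)
    exists (fun s => if s is k :: _ then F k else set0); split.
      by case=> [|k _]; [split=> //; exact: negligible_set0|exact: cC.1 (svalP k)].
    by move=> x /covF[k _ Fkx]; exists [:: k].
  move=> C' C'0 covC'; apply: card_le_trans (seq_null_cover_card cC) _.
  exact: Cmin.
all: by apply: (pos_coneable_trace_net covF) => n c T c0; have [] := null n c T c0.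
Qed.
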